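(* Let $G$ be a finite $2$-generated nilpotent group. Then $\Delta(G)$ is maximally connected, that is, $\kappa(\Delta(G)) = \delta(\Delta(G))$.
   Context: A group is $2$-generated if it can be generated by two elements (cyclic groups are included). The generating graph $\Gamma(G)$ of a finite group $G$ is the graph whose vertices are the elements of $G$ and where $g,h \in G$ are adjacent if $G = \langle g,h\rangle$ (loops are not included when $G$ is cyclic). $\Delta(G)$ is the graph obtained from $\Gamma(G)$ by removing its isolated vertices. For a finite graph $\Gamma$, $\delta(\Gamma)$ is the minimal vertex degree, and the (vertex) connectivity $\kappa(\Gamma)$ is the least number of vertices of $\Gamma$ that can be removed such that the induced subgraph on the remaining vertices is disconnected, with the convention $\kappa(K_n) = n-1$ for the complete graph $K_n$ on $n$ vertices. The graph $\Gamma$ is maximally connected if $\kappa(\Gamma)=\delta(\Gamma)$. *)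

(* Defs.v *)
From mathcomp Require Import all_boot all_fingroup all_solvable.

Set Implicit Arguments.
Unset Strict Implicit.
Unset Printing Implicit Defensive.

Local Open Scope group_scope.

(* Only the values of adj on pairs of vertices are meaningful: every notion
   below is restricted to verts. *)
Record sgraph (T : finType) := SGraph {
  verts : {set T};
  adj : rel T;
  adj_sym : symmetric adj;
  adj_irr : irreflexive adj
}.

Section Graphs.

Variable T : finType.
Implicit Types (Γ : sgraph T) (S : {set T}).

Definition induced Γ S : sgraph T :=
  SGraph (verts Γ :&: S) (@adj_sym T Γ) (@adj_irr T Γ).

Definition degree Γ (x : T) : nat := #|[set y in verts Γ | adj Γ x y]|.

(* Degrees are smaller than #|verts Γ|, so the default value of the minimum is
   reached only by the graph with no vertices, whose minimal degree is 0. *)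
Definition min_degree Γ : nat :=
  \big[minn/#|verts Γ|]_(x in verts Γ) degree Γ x.

Definition complete Γ : bool :=
  [forall x in verts Γ, forall y in verts Γ, (x != y) ==> adj Γ x y].

Definition disconnected Γ : bool :=
  [exists x in verts Γ, exists y in verts Γ,
    ~~ connect [rel u v | [&& u \in verts Γ, v \in verts Γ & adj Γ u v]] x y].

(* In a graph that is not complete, removing all vertices but two nonadjacent
   ones disconnects it, so the default value of the minimum is never reached.
   The graph with no vertices counts as complete and gets connectivity 0. *)
Definition connectivity Γ : nat :=
  if complete Γ then #|verts Γ|.-1
  else \big[minn/#|verts Γ|]_(S : {set T} | (S \subset verts Γ)
         && disconnected (induced Γ (~: S))) #|S|.

Definition maximally_connected Γ : Prop := connectivity Γ = min_degree Γ.

Definition del_isolated Γ : sgraph T :=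
  induced Γ [set x in verts Γ | degree Γ x != 0%N].

End Graphs.

Section GeneratingGraph.

Variables (gT : finGroupType) (G : {group gT}).

Definition two_generated : Prop := exists x y : gT, G :=: <<[set x; y]>>.

Definition gen_adj : rel gT :=
  fun x y => (x != y) && (<<[set x; y]>> == G :> {set gT}).

Lemma gen_adj_sym : symmetric gen_adj.
Proof. by move=> x y; rewrite /gen_adj eq_sym setUC. Qed.

Lemma gen_adj_irr : irreflexive gen_adj.
Proof. by move=> x; rewrite /gen_adj eqxx. Qed.

Definition gen_graph : sgraph gT := SGraph G gen_adj_sym gen_adj_irr.

Definition Delta : sgraph gT := del_isolated gen_graph.

End GeneratingGraph.

(* Main.v *)
Require Import Defs.
From mathcomp Require Import all_boot all_order all_fingroup all_solvable.

Set Implicit Arguments.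
Unset Strict Implicit.
Unset Printing Implicit Defensive.

Import Order.TTheory.

(** Write [M_p] for the set of maximal subgroups of index [p] of [G]
    ([max_index p]), [D_p] for their intersection ([frat_at p]), and [A] for the
    set of primes [p] with more than one element in [M_p] ([free_index]).

    Maximal subgroups of a nilpotent group are normal of prime index, and [G / D_p]
    is an elementary abelian [p]-group generated by two elements.  Hence for [p] in
    [A] its order is [p ^ 2], any two members of [M_p] meet in [D_p], and an element
    [x] outside [D_p] lies in exactly one member of [M_p], namely [<[x]> D_p]
    ([frat_join]).  Let [coords x] be the family of these subgroups over [p] in [A],
    a point of the product of the [M_p] ([max_box]).  If [x] is a vertex of
    [Delta G] and [v] lies in no [D_p] at all ([v \in frat_free]), then [x] and [v]
    generate [G] exactly when their coordinates differ everywhere ([box_adj_gen],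
    [gen_box_adj]).

    All fibres of [coords] on [frat_free] have the same size [m]: elements of the
    Sylow [p]-subgroup change only what happens at [p], so the condition at [p] is
    statistically independent of the others ([card_setI_supplement],
    [card_fiber_update]).  Therefore every vertex has the same number [d] of
    neighbours in [frat_free], where [d] is [m] times the product of the
    [#|M_p| - 1] over [A] ([free_degree], [card_free_nbrs]).

    The connectivity is at most the minimal degree in any graph.  The minimal degree
    is at most [d]: a vertex that lies in [D_p] for every [p] outside [A] has no
    neighbours outside [frat_free].  Finally, a cut [S] has at least [d] elements.
    Otherwise every remaining vertex has a remaining neighbour in [frat_free], so
    that [S] separates two points of [frat_free].  This contradicts [blowup_cut]:
    on [frat_free] the graph is a blow-up of a direct product of complete graphs with
    at least three vertices each, and such a product is edge-transitive and
    connected.  For it the claim is [biclique_box], proved as Watkins and Mader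
    prove that connected edge-transitive graphs are maximally connected: the two
    sides of a smallest cut form a maximum biclique of the complementary graph; among
    these bicliques take one with the smallest possible side, an atom.  An atom is
    preserved by every automorphism that fixes one of its points
    ([atom_stable]), which forces an atom containing an edge to be everything. *)

(** * Connectivity and minimal degree *)

Section GraphConnectivity.

Variables (T : finType) (Γ : sgraph T).
Implicit Types (x : T) (S : {set T}).

Lemma min_degree_le x : x \in verts Γ -> min_degree Γ <= degree Γ x.
Proof. by rewrite /min_degree -minEnat -leEnat; apply: bigmin_le_cond. Qed.

Lemma min_degree_attained x0 :
  x0 \in verts Γ -> exists2 x, x \in verts Γ & degree Γ x = min_degree Γ.
Proof.
move=> Vx0; case: (arg_minnP (degree Γ) Vx0) => x Vx le_x; exists x => //.
apply/eqP; rewrite eqn_leq min_degree_le // andbT /min_degree -minEnat.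
rewrite -leEnat; apply/bigmin_geP; split=> //.
by apply/subset_leq_card/subsetP=> y; rewrite inE; case/andP.
Qed.

Lemma degree_complete x :
  complete Γ -> x \in verts Γ -> degree Γ x = #|verts Γ|.-1.
Proof.
move=> /forall_inP cG Vx; rewrite (cardsD1 x) Vx /=; apply: eq_card => y.
rewrite !inE; have [->|neq_yx] := eqVneq y x; first by rewrite adj_irr andbF.
have [Vy|//] := boolP (y \in _).
by move/forall_inP/(_ y Vy): (cG x Vx); rewrite eq_sym neq_yx.
Qed.

Lemma connectivity_le S :
    ~~ complete Γ -> S \subset verts Γ -> disconnected (induced Γ (~: S)) ->
  connectivity Γ <= #|S|.
Proof.
move=> /negPf ncG sSV dS; rewrite /connectivity ncG -minEnat.
by rewrite -leEnat; apply: bigmin_le_cond; rewrite sSV.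
Qed.

(** Removing the neighbours of a vertex of minimal degree isolates it, and in a
    graph that is not complete some other vertex remains. *)
Lemma connectivity_le_min_degree : connectivity Γ <= min_degree Γ.
Proof.
have [cG|ncG] := boolP (complete Γ).
  rewrite /connectivity cG; have [->|[x0 Vx0]] := set_0Vmem (verts Γ).
    by rewrite cards0.
  by have [x Vx <-] := min_degree_attained Vx0; rewrite degree_complete.
have /forall_inPn[u Vu /forall_inPn[v Vv]] := ncG.
rewrite negb_imply => /andP[neq_uv nadj_uv].
have [x Vx dx] := min_degree_attained Vu.
set N := [set y in verts Γ | adj Γ x y].
have cardN : #|N| = min_degree Γ by [].
have [y Vy /norP[nxy neq_yx]] :
    exists2 y, y \in verts Γ & ~~ (adj Γ x y || (y == x)).
  (* Otherwise the minimal degree is [#|verts Γ| - 1], and [Γ] is complete. *)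
  apply/exists_inP; apply: contraNT ncG; rewrite negb_exists_in => /forall_inP allN.
  have ltN: #|N|.+1 = #|verts Γ|.
    rewrite (cardsD1 x (verts Γ)) Vx; congr _.+1; apply: eq_card => z.
    rewrite !inE andbC; have [Vz|] := boolP (z \in _); last by rewrite !andbF.
    have [->|neq_zx] := eqVneq z x; first by rewrite adj_irr.
    by move: (allN z Vz); rewrite negbK (negPf neq_zx) orbF => ->.
  apply/forall_inP=> z Vz; apply/forall_inP=> t Vt; apply/implyP=> neq_zt.
  have: verts Γ :\ z \subset [set y in verts Γ | adj Γ z y].
    suff /eqP-> : [set y in verts Γ | adj Γ z y] == verts Γ :\ z by [].
    rewrite eqEcard; apply/andP; split.
      apply/subsetP=> s; rewrite !inE => /andP[-> azs]; rewrite andbT.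
      by apply: contraTneq azs => ->; rewrite adj_irr.
    have cardD : #|verts Γ| = #|verts Γ :\ z|.+1 by rewrite (cardsD1 z) Vz.
    by rewrite -ltnS -cardD -ltN ltnS cardN min_degree_le.
  move/subsetP/(_ t); rewrite !inE eq_sym neq_zt Vt /=; exact.
rewrite -cardN; apply: connectivity_le => //.
  by apply/subsetP=> z; rewrite inE => /andP[].
apply/exists_inP; exists x; first by rewrite !inE Vx adj_irr.
apply/exists_inP; exists y; first by rewrite !inE Vy (negPf nxy).
apply/negP=> /connectP[[|z p] /=]; first by move=> _ /eqP; rewrite (negPf neq_yx).
by rewrite !inE => /andP[/and3P[_ /andP[-> /negP]]].
Qed.

(** Reduces the equality to a lower bound for the size of a cut; for a complete
    graph both sides are the number of vertices minus one. *)
Lemma maximally_connectedP :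
    (forall S, ~~ complete Γ -> S \subset verts Γ ->
       disconnected (induced Γ (~: S)) -> min_degree Γ <= #|S|) ->
  maximally_connected Γ.
Proof.
move=> cutP; apply/eqP; rewrite eqn_leq connectivity_le_min_degree /=.
rewrite /connectivity; case: ifPn => [cG|ncG].
  have [V0|[x Vx]] := set_0Vmem (verts Γ).
    by rewrite /min_degree big_pred0 ?V0 ?cards0 // => x; rewrite inE.
  by rewrite -(degree_complete cG Vx) min_degree_le.
rewrite -minEnat -leEnat; apply/bigmin_geP; split; last first.
  by move=> S /andP[]; exact: cutP.
have /forall_inPn[u Vu _] := ncG; apply: leq_trans (min_degree_le Vu) _.
by apply/subset_leq_card/subsetP=> y; rewrite inE; case/andP.
Qed.

End GraphConnectivity.

(** * Maximum bicliques *)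

Section Bicliques.

Variables (T : finType) (r : rel T) (V : {set T}).
Hypothesis r_sym : symmetric r.
Implicit Types (X Y : {set T}) (f : T -> T).

(** With [r] the nonadjacency of distinct vertices of a graph, a biclique is the
    pair of sides of a separation by the remaining vertices; a cut is small when its
    biclique is large. *)
Definition biclique X Y : bool :=
  [&& X \subset V, Y \subset V, X != set0, Y != set0
    & [forall x in X, forall y in Y, r x y]].

Lemma bicliqueP X Y :
  reflect [/\ X \subset V, Y \subset V, X != set0, Y != set0
            & {in X & Y, forall x y, r x y}] (biclique X Y).
Proof.
apply: (iffP and5P) => -[-> -> -> -> rXY]; split=> //.
  by move=> x y Xx Yy; move/forall_inP/(_ x Xx)/forall_inP/(_ y Yy): rXY.
by apply/forall_inP=> x Xx; apply/forall_inP=> y; apply: rXY.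
Qed.

Lemma biclique_sym X Y : biclique X Y = biclique Y X.
Proof.
by apply/bicliqueP/bicliqueP=> -[? ? ? ? rXY];
  split=> // x y ? ?; rewrite r_sym rXY.
Qed.

(** Since [biclique] is symmetric, the side [X] of an atom is also no larger than
    the second side of any maximum biclique. *)
Definition atom X Y : Prop :=
  biclique X Y /\ forall X' Y', biclique X' Y' ->
    #|X'| + #|Y'| <= #|X| + #|Y|
    /\ (#|X| + #|Y| <= #|X'| + #|Y'| -> #|X| <= #|X'|).

Lemma atom_exists X0 Y0 :
  biclique X0 Y0 -> exists X Y, #|X0| + #|Y0| <= #|X| + #|Y| /\ atom X Y.
Proof.
pose good (p : {set T} * {set T}) := biclique p.1 p.2.
pose sz (p : {set T} * {set T}) := #|p.1| + #|p.2|.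
move=> b0; have g0: good (X0, Y0) by [].
case: (arg_maxnP sz g0) => p1 gp1 max1.
have g1: good p1 && (sz p1 <= sz p1) by rewrite gp1 /=.
case: (arg_minnP (P := fun p => good p && (sz p1 <= sz p)) (fun p => #|p.1|) g1).
move=> [X Y] /andP[gXY leXY] minX; exists X, Y; split.
  by apply: leq_trans leXY; apply: (max1 (X0, Y0)).
split=> // X' Y' b'; split; first by apply: leq_trans leXY; apply: (max1 (X', Y')).
by move=> le'; apply: (minX (X', Y')); rewrite [good _]b' /=; apply: leq_trans le'.
Qed.

(** The atom [(X, Y)] and its image [(X', Y')] combine into the bicliques
    [(X :&: X', Y :|: Y')] and [(X :|: X', Y :&: Y')], whose sizes add up to
    twice the maximum.  When both are nondegenerate the first one is maximum, so
    minimality of [X] gives [X :&: X' = X]; the second one cannot degenerate,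
    since [X] is not larger than [Y]. *)
Lemma atom_stable X Y f x :
    injective f -> {in V, forall z, f z \in V} ->
    {in V &, forall z t, r (f z) (f t) = r z t} ->
    atom X Y -> x \in X -> f x = x ->
  {in X, forall z, f z \in X}.
Proof.
move=> f_inj fV fr [bXY opt] Xx fx.
have [sXV sYV X0 Y0 rXY] := bicliqueP _ _ bXY.
set X' := f @: X; set Y' := f @: Y.
have cX' : #|X'| = #|X| by rewrite card_imset.
have cY' : #|Y'| = #|Y| by rewrite card_imset.
have sX'V: X' \subset V.
  by apply/subsetP=> _ /imsetP[z Xz ->]; rewrite fV ?(subsetP sXV).
have sY'V: Y' \subset V.
  by apply/subsetP=> _ /imsetP[z Yz ->]; rewrite fV ?(subsetP sYV).
have rX'Y' : {in X' & Y', forall x y, r x y}.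
  move=> _ _ /imsetP[z Xz ->] /imsetP[t Yt ->].
  rewrite fr; [exact: rXY | exact: (subsetP sXV) | exact: (subsetP sYV)].
have X'x : x \in X' by rewrite -fx imset_f.
have bI : biclique (X :&: X') (Y :|: Y').
  apply/bicliqueP; split.
  - by rewrite (subset_trans (subsetIl _ _)).
  - by rewrite subUset sYV.
  - by apply/set0Pn; exists x; rewrite inE Xx.
  - by apply: contraNneq Y0 => /eqP; rewrite setU_eq0 => /andP[].
  move=> z t /setIP[Xz X'z] /setUP[]; [exact: rXY | exact: rX'Y'].
have [leI minI] := opt _ _ bI.
have cXX' := cardsUI X X'; have cYY' := cardsUI Y Y'.
rewrite cX' in cXX'; rewrite cY' in cYY'.
have leXY : #|X| <= #|Y|.
  by rewrite biclique_sym in bXY; apply: (opt _ _ bXY).2; rewrite addnC.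
have I0 : 0 < #|X :&: X'| by apply/card_gt0P; exists x; rewrite inE Xx.
have YI0 : Y :&: Y' != set0.
  apply/eqP=> YI0; rewrite YI0 cards0 addn0 in cYY'.
  (* Then [X :&: X'] and [Y :|: Y'] have together more elements than [Y] and [Y'],
     hence more than [X] and [Y]. *)
  rewrite cYY' in leI; move: leI; rewrite addnA leq_add2r leqNgt => /negP[].
  by rewrite -add1n leq_add.
have bU : biclique (X :|: X') (Y :&: Y').
  apply/bicliqueP; split=> //.
  - by rewrite subUset sXV.
  - by rewrite (subset_trans (subsetIl _ _)).
  - by apply/set0Pn; exists x; rewrite inE Xx.
  move=> z t /setUP[] Zz /setIP[Yt Y't]; [exact: rXY | exact: rX'Y'].
have [leU _] := opt _ _ bU.
have /minI leXI : #|X| + #|Y| <= #|X :&: X'| + #|Y :|: Y'|.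
  rewrite -(leq_add2r (#|X :|: X'| + #|Y :&: Y'|)) [X in _ <= X]addnACA cYY'.
  by rewrite [#|X :&: X'| + _]addnC cXX' [X in _ <= X]addnACA leq_add2l.
have /eqP XI : X :&: X' == X by rewrite eqEcard subsetIl.
have sXX' : X \subset X' by rewrite -XI subsetIr.
have /eqP eX : X == X' by rewrite eqEcard sXX' cX' /=.
by move=> z Xz; rewrite eX imset_f.
Qed.

End Bicliques.

(** * Products of complete graphs *)

Section Box.

Variables (I J : finType) (F : I -> {set J}).
Implicit Types (w v : {ffun I -> J}) (i : I) (a b : J).

Definition box : {set {ffun I -> J}} := [set w | w \in family F].

Definition box_adj : rel {ffun I -> J} := fun w v => [forall i, w i != v i].

Definition box_degree : nat := \prod_i #|F i|.-1.

Definition update w i b : {ffun I -> J} := finfun [eta w with i |-> b].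

Definition swap i a b w := update w i (tperm a b (w i)).

Lemma boxP w : reflect (forall i, w i \in F i) (w \in box).
Proof. by rewrite inE; apply: familyP. Qed.

Lemma box_adj_sym : symmetric box_adj.
Proof. by move=> w v; apply: eq_forallb => i; rewrite eq_sym. Qed.

Lemma updateE w i b j : update w i b j = if j == i then b else w j.
Proof. by rewrite ffunE. Qed.

Lemma update_box w i b : w \in box -> b \in F i -> update w i b \in box.
Proof.
move=> /boxP Fw Fb; apply/boxP=> j; rewrite updateE.
by case: eqP => [->|].
Qed.

(** Changing one coordinate at a time leads from any point of the box to any
    other. *)
Lemma box_ind (P : {ffun I -> J} -> Prop) w :
    w \in box -> P w ->
    (forall v i b, v \in box -> b \in F i -> P v -> P (update v i b)) ->
  {in box, forall v, P v}.
Proof.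
move=> Bw Pw stepP v Bv.
pose mix (s : seq I) : {ffun I -> J} := [ffun i => if i \in s then v i else w i].
suff /(_ (enum I)) [_] : forall s, mix s \in box /\ P (mix s).
  by congr P; apply/ffunP=> i; rewrite ffunE mem_enum.
elim=> [|i s [Bs Ps]].
  by have -> : mix [::] = w; first by apply/ffunP=> i; rewrite ffunE.
have -> : mix (i :: s) = update (mix s) i (v i).
  by apply/ffunP=> j; rewrite updateE !ffunE inE; case: eqP => [->|].
have Fv : v i \in F i by move/boxP: Bv.
by split; [exact: update_box | exact: stepP].
Qed.

Lemma card_box_adj w :
  w \in box -> #|[set v in box | box_adj w v]| = box_degree.
Proof.
move=> /boxP Fw; pose G i := F i :\ w i.
have -> : #|[set v in box | box_adj w v]| = #|family G|.
  apply: eq_card => v; rewrite inE; apply/andP/familyP.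
    by case=> /boxP Fv /forallP wv i; rewrite !inE eq_sym wv Fv.
  move=> Gv; split; first by apply/boxP=> i; case/setD1P: (Gv i).
  by apply/forallP=> i; case/setD1P: (Gv i); rewrite eq_sym.
rewrite card_family foldrE big_map big_enum; apply: eq_bigr => i _.
by rewrite /G [in RHS](cardsD1 (w i)) Fw.
Qed.

Lemma swap_inj i a b : injective (swap i a b).
Proof.
apply: (can_inj (g := swap i a b)) => w; apply/ffunP=> j.
by rewrite /swap !updateE eqxx; have [->|] := eqVneq j i; rewrite ?tpermK.
Qed.

Lemma swap_box i a b w :
  a \in F i -> b \in F i -> w \in box -> swap i a b w \in box.
Proof.
move=> Fa Fb Bw; apply: update_box => //.
by case: tpermP => // _ _; move/boxP: Bw.
Qed.

Lemma swap_adj i a b w v : box_adj (swap i a b w) (swap i a b v) = box_adj w v.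
Proof.
apply: eq_forallb => j; rewrite !updateE; have [->|//] := eqVneq j i.
by rewrite (inj_eq perm_inj).
Qed.

Definition box_far : rel {ffun I -> J} := fun w v => (w != v) && ~~ box_adj w v.

Lemma box_far_sym : symmetric box_far.
Proof. by move=> w v; rewrite /box_far eq_sym box_adj_sym. Qed.

Hypothesis F_gt2 : forall i, 2 < #|F i|.

(** Edge-transitivity enters through the swaps: exchanging two values at one
    coordinate fixes every point that takes neither of them there.  So if an atom
    contains an edge [(w, v)], then it contains [update v i b] for all
    [b != w i].  With at least three values per coordinate both ends of the edge
    can thus be moved to any value, and the atom is the whole box. *)
Lemma biclique_box X Y :
  biclique box_far box X Y -> #|X| + #|Y| + box_degree <= #|box|.
Proof.
move=> b0; have [X1 [Y1 [leXY atXY]]] := atom_exists b0.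
apply: leq_trans (leq_add leXY (leqnn _)) _; move: X1 Y1 atXY {leXY b0} => {}X {}Y atXY.
have [bXY _] := atXY; have [sX sY X0 Y0 farXY] := bicliqueP _ _ _ _ bXY.
have disjXY : [disjoint X & Y].
  by apply/pred0P=> z /=; apply/negP=> /andP[Xz /(farXY z z Xz)/andP[/eqP]].
have [/existsP[w /existsP[v /and3P[Xw Xv wv]]]|noE] :=
    boolP [exists w, exists v, [&& w \in X, v \in X & box_adj w v]]; last first.
  (* An atom without edges leaves all neighbours of each of its points out. *)
  have [w Xw] := set0Pn _ X0; have Bw := subsetP sX w Xw.
  rewrite -(card_box_adj Bw); set N := [set v in box | _].
  have sN : N \subset box by apply/subsetP=> v; rewrite inE => /andP[].
  have disjN : [disjoint X :|: Y & N].
    apply/pred0P=> v /=; apply/negP=> /andP[XYv]; rewrite inE => /andP[Bv wv].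
    case/setUP: XYv => [Xv|Yv].
      by case/negP: noE; apply/existsP; exists w; apply/existsP; exists v; apply/and3P.
    by case/andP: (farXY w v Xw Yv) => _; rewrite wv.
  move: (disjXY) (disjN); rewrite -!leq_card_setU => /eqP <- /eqP <-.
  by rewrite subset_leq_card // !subUset sX sY.
have stepX u z i b : u \in X -> z \in X -> box_adj u z -> b \in F i -> b != u i ->
    update z i b \in X.
  move=> Xu Xz uz Fb neq_b; have Bz := subsetP sX z Xz.
  have -> : update z i b = swap i (z i) b z by rewrite /swap tpermL.
  have Fz : z i \in F i by move/boxP: Bz.
  apply: (atom_stable box_far_sym (@swap_inj i (z i) b) _ _ atXY Xu) => //.
  - by move=> t; apply: swap_box.
  - by move=> t s _ _; rewrite /box_far swap_adj (inj_eq (@swap_inj i _ _)).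
  apply/ffunP=> j; rewrite updateE; have [->|//] := eqVneq j i.
  by rewrite tpermD // eq_sym; move/forallP: uz => /(_ i); rewrite eq_sym.
(* Carrying a neighbour [t] in [X] along makes the induction go through: if [b] is
   the value of [t] at [i], a third value [c] first moves [t] out of the way. *)
suff allX : {in box, forall z, exists2 t, t \in X & z \in X /\ box_adj z t}.
  have [y Yy] := set0Pn _ Y0; have [t _ [Xy _]] := allX y (subsetP sY y Yy).
  by have:= disjointFr disjXY Xy; rewrite Yy.
apply: (box_ind (subsetP sX w Xw)); first by exists v.
move=> z i b Bz Fb [t Xt [Xz zt]].
have [c Fc /andP[neq_cz neq_cb]] : exists2 c, c \in F i & (c != z i) && (c != b).
  have /subsetPn[c Fc] : ~~ (F i \subset [set z i; b]).
    apply: contraTN (F_gt2 i) => /subset_leq_card le2; rewrite -leqNgt.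
    by rewrite (leq_trans le2) // cards2; case: (_ != _).
  by rewrite !inE negb_or; exists c.
have Xt' : update t i c \in X by apply: (stepX z t).
have zt' : box_adj z (update t i c).
  apply/forallP=> j; rewrite updateE; have [->|_] := eqVneq j i.
    by rewrite eq_sym.
  by move/forallP: zt.
exists (update t i c) => //; split.
  apply: (stepX (update t i c) z) => //; first by rewrite box_adj_sym.
  by rewrite updateE eqxx eq_sym.
apply/forallP=> j; rewrite !updateE; have [_|_] := eqVneq j i; first by rewrite eq_sym.
by move/forallP: zt.
Qed.

End Box.

(** * Blow-ups of boxes *)

Section BlowUp.

Variables (I J T : finType) (F : I -> {set J}).
Variables (O : {set T}) (c : T -> {ffun I -> J}) (m : nat).
Hypothesis F_gt2 : forall i, 2 < #|F i|.
Hypothesis c_box : {in O, forall x, c x \in box F}.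
Hypothesis card_fiber : {in box F, forall w, #|[set x in O | c x == w]| = m}.
Implicit Types (S X Y : {set T}).

Lemma card_preim_box (B : {set {ffun I -> J}}) :
  B \subset box F -> #|[set x in O | c x \in B]| = m * #|B|.
Proof.
move=> sB; rewrite -sum1_card (partition_big c [in B]) => [|x]; last first.
  by rewrite inE => /andP[].
rewrite mulnC -sum_nat_const; apply: eq_bigr => w Bw.
rewrite -(card_fiber (subsetP sB w Bw)) -sum1_card; apply: eq_bigl => x.
by rewrite !inE; case: eqP => [->|]; rewrite ?Bw ?andbT ?andbF.
Qed.

Lemma card_blowup_adj w :
  w \in box F -> #|[set v in O | box_adj w (c v)]| = m * box_degree F.
Proof.
move=> Bw; rewrite -(card_box_adj Bw) -card_preim_box; last first.
  by apply/subsetP=> v; rewrite inE => /andP[].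
apply: eq_card => x; rewrite [LHS]inE [RHS]inE; have [Ox|//] := boolP (x \in O).
by rewrite [in RHS]inE c_box.
Qed.

(** If the two parts of a separation meet a common fibre, then the neighbourhood
    of that fibre is removed; otherwise the separation descends to the box. *)
Lemma blowup_cut S X Y :
    X != set0 -> Y != set0 -> X :|: Y = O :\: S ->
    {in X & Y, forall x y, (x != y) && ~~ box_adj (c x) (c y)} ->
  m * box_degree F <= #|S|.
Proof.
move=> X0 Y0 defXY farXY.
have XYO z : z \in X :|: Y -> z \in O by rewrite defXY => /setDP[].
have XO : {in X, forall x, x \in O} by move=> x Xx; rewrite XYO // inE Xx.
have YO : {in Y, forall y, y \in O} by move=> y Yy; rewrite XYO // inE Yy orbT.
pose cX := c @: X; pose cY := c @: Y.
have [[w /setIP[/imsetP[x Xx cx] /imsetP[y Yy cy]]]|disjc] :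
    (exists w, w \in cX :&: cY) \/ cX :&: cY = set0.
  by have [->|] := set_0Vmem (cX :&: cY); [right | case=> w; left; exists w].
  rewrite -(card_blowup_adj (c_box (XO x Xx))); apply/subset_leq_card/subsetP=> v.
  rewrite inE => /andP[Ov adj_v]; apply: contraLR adj_v => Sv.
  have: v \in X :|: Y by rewrite defXY inE Sv.
  case/setUP=> [Xv|Yv]; last by case/andP: (farXY x v Xx Yv).
  by rewrite -cx cy box_adj_sym; case/andP: (farXY v y Xv Yy).
have bXY : biclique (@box_far I J) (box F) cX cY.
  apply/bicliqueP; split.
  - by apply/subsetP=> _ /imsetP[x Xx ->]; rewrite c_box ?XO.
  - by apply/subsetP=> _ /imsetP[y Yy ->]; rewrite c_box ?YO.
  - by have [x Xx] := set0Pn _ X0; apply/set0Pn; exists (c x); rewrite imset_f.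
  - by have [y Yy] := set0Pn _ Y0; apply/set0Pn; exists (c y); rewrite imset_f.
  move=> w v cXw cYv; apply/andP; split.
    by apply: contraPneq disjc => eq_wv; apply/eqP/set0Pn; exists w;
      rewrite inE cXw eq_wv.
  have /imsetP[x Xx ->] := cXw; have /imsetP[y Yy ->] := cYv.
  by case/andP: (farXY x y Xx Yy).
have : m * (#|cX| + #|cY| + box_degree F) <= m * #|box F|.
  by rewrite leq_mul2l (biclique_box F_gt2 bXY) orbT.
have le_im (Z : {set T}) : {in Z, forall z, z \in O} -> c @: Z \subset box F ->
    #|Z| <= m * #|c @: Z|.
  move=> ZO sB; rewrite -card_preim_box //; apply/subset_leq_card/subsetP=> z Zz.
  by rewrite inE ZO ?imset_f.
have [sX sY _ _ _] := bicliqueP _ _ _ _ bXY.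
have cardO : #|O| = m * #|box F|.
  rewrite -card_preim_box //; apply: eq_card => x; rewrite inE.
  by have [Ox|//] := boolP (x \in O); rewrite c_box.
rewrite -cardO => le_O; rewrite -(leq_add2l (m * (#|cX| + #|cY|))) -mulnDr.
apply: leq_trans le_O _; rewrite -(cardsID S O) addnC -defXY leq_add //.
  by rewrite mulnDr (leq_trans (leq_card_setU X Y)) // leq_add ?le_im.
by rewrite subset_leq_card ?subsetIr.
Qed.

End BlowUp.

(** * Maximal subgroups of a nilpotent group *)

Local Open Scope group_scope.

Section MaximalSubgroups.

Variables (gT : finGroupType) (G : {group gT}).
Implicit Types (M N H : {group gT}) (p : nat) (x y u v : gT).

Definition max_index p : {set {group gT}} :=
  [set M : {group gT} | maximal M G & #|G : M| == p].

(** The intersection with [G] matters only when [max_index p] is empty. *)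
Definition frat_at p : {set gT} := G :&: \bigcap_(M in max_index p) M.

Canonical frat_at_group p := [group of frat_at p].

Lemma max_indexP p M :
  reflect (maximal M G /\ #|G : M| = p) (M \in max_index p).
Proof. by rewrite inE; apply: (iffP andP) => -[-> /eqP]. Qed.

Lemma frat_atP p x :
  reflect (x \in G /\ {in max_index p, forall M, x \in M}) (x \in frat_at p).
Proof.
rewrite inE; apply: (iffP andP) => -[Gx].
  by move/bigcapP=> frx; split=> // M /frx.
by move=> frx; split=> //; apply/bigcapP.
Qed.

Lemma frat_at_sub p M : M \in max_index p -> frat_at p \subset M.
Proof. by move=> maxM; apply/subsetP=> x /frat_atP[_ ->]. Qed.

Lemma gen2P x y :
    x \in G -> y \in G ->
  reflect (forall M, maximal M G -> x \in M -> y \notin M) (<<[set x; y]>> == G).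
Proof.
move=> Gx Gy; have sG : <<[set x; y]>> \subset G.
  by rewrite gen_subG subUset !sub1set Gx.
apply: (iffP eqP) => [defG M maxM Mx|noM].
  apply: contraL (maxgroupp maxM) => My; rewrite properE negb_and negbK -defG.
  by rewrite gen_subG subUset !sub1set Mx My orbT.
have [//|[M maxM sM]] := maximal_exists sG.
have Mxy z : z \in [set x; y] -> z \in M by move=> xyz; rewrite (subsetP sM) ?mem_gen.
by have := noM M maxM (Mxy x (set21 x y)); rewrite Mxy ?set22.
Qed.

Hypothesis G_nil : nilpotent G.

Lemma maximal_nil_normal M : maximal M G -> M <| G.
Proof.
move=> maxM; have [sMG _] := andP (maxgroupp maxM).
have ltMN := nilpotent_proper_norm G_nil (maxgroupp maxM).
rewrite /normal sMG; have [//|ltNG] := eqVproper (subsetIl G 'N(M)).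
  by move/setIidPl.
have /maxgroupP[_ /(_ 'N_G(M)%G ltNG (proper_sub ltMN)) eqM] := maxM.
by move: ltMN; rewrite (eqM : 'N_G(M) = M) properxx.
Qed.

Lemma maximal_nil_prime_index M : maximal M G -> prime #|G : M|.
Proof.
move=> maxM; have nMG := maximal_nil_normal maxM.
move: (nilpotent_sol G_nil) => solG; apply: (index_maxnormal_sol_prime solG).
apply/maxgroupP; split; first by rewrite (maxgroupp maxM) normal_norm.
by move=> H /andP[ltHG _]; case/maxgroupP: maxM => _; apply.
Qed.

Lemma max_index_prime p M : M \in max_index p -> prime p.
Proof. by case/max_indexP=> /maximal_nil_prime_index + <-. Qed.

Lemma max_index_normal p M : M \in max_index p -> M <| G.
Proof. by case/max_indexP=> /maximal_nil_normal. Qed.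

(** The quotient by a member of [max_index p] is a [p]-group. *)
Lemma p'elt_max_index p M x :
  M \in max_index p -> x \in G -> p^'.-elt x -> x \in M.
Proof.
move=> maxM Gx p'x; have /andP[_ nMG] := max_index_normal maxM.
have Nx := subsetP nMG x Gx; apply: coset_idr => //.
have p_pr := max_index_prime maxM; have [_ iM] := max_indexP _ _ maxM.
have pQ : p.-group (G / M) by rewrite /pgroup card_quotient // iM pnat_id.
apply/eqP; rewrite -order_eq1; apply/eqP; apply: (@pnat_1 p).
  by apply: mem_p_elt pQ _; rewrite mem_quotient.
exact: (morph_p_elt (coset_morphism M)).
Qed.

Lemma p'elt_frat_at p x : x \in G -> p^'.-elt x -> x \in frat_at p.
Proof.
by move=> Gx p'x; apply/frat_atP; split=> // M maxM; apply: p'elt_max_index p'x.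
Qed.

Lemma frat_at_normal p : frat_at p <| G.
Proof.
rewrite /normal subsetIl normsI ?normG //.
apply: norms_bigcap; apply/bigcapsP=> M maxM.
by rewrite normal_norm ?(max_index_normal maxM).
Qed.

Lemma frat_at_abelem p : prime p -> p.-abelem (G / frat_at p).
Proof.
move=> p_pr; have /andP[sDG nDG] := frat_at_normal p.
apply/abelemP=> //; split.
  apply: sub_der1_abelian; rewrite subsetI der_sub.
  apply/bigcapsP=> M maxM; have /andP[_ nMG] := max_index_normal maxM.
  apply: der1_min => //; apply: cyclic_abelian; apply: prime_cyclic.
  by rewrite card_quotient //; case/max_indexP: maxM => _ ->.
move=> _ /morphimP[x Nx Gx ->]; rewrite -morphX //; apply: coset_id.
apply/frat_atP; split=> [|M maxM]; first by rewrite groupX.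
have /andP[_ nMG] := max_index_normal maxM; have NMx := subsetP nMG x Gx.
apply: coset_idr; first by rewrite groupX.
have [_ iM] := max_indexP _ _ maxM.
rewrite morphX //; apply/eqP; rewrite -order_dvdn -[X in _ %| X]iM -card_quotient //.
by rewrite order_dvdG ?mem_quotient.
Qed.

Hypothesis G_2gen : two_generated G.

(** An elementary abelian [p]-group generated by two elements has order at most
    [p ^ 2]. *)
Lemma index_frat_at_le p : prime p -> #|G : frat_at p| <= p ^ 2.
Proof.
move=> p_pr; have [x [y defG]] := G_2gen.
have /andP[sDG nDG] := frat_at_normal p.
have [abQ expQ] := (abelemP p_pr (frat_at_abelem p_pr)).
have [Gx Gy] : x \in G /\ y \in G by rewrite defG !mem_gen ?set21 ?set22.
set D := frat_at p; set X := <[coset D x]>; set Y := <[coset D y]>.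
have defQ : G / D = X * Y.
  have Nxy : [set x; y] \subset 'N(D).
    by rewrite subUset !sub1set !(subsetP nDG).
  rewrite {1}defG quotient_gen // quotientU !quotient_set1 ?(subsetP nDG) //.
  have cXY : Y \subset 'C(X).
    rewrite cycle_subG /= cent_cycle; apply/cent1P.
    by apply: (centsP abQ); rewrite mem_quotient.
  by rewrite -cent_joinEr // joing_idl joing_idr.
have le_p z : z \in G -> #|<[coset D z]>| <= p.
  move=> Gz; apply: dvdn_leq; first exact: prime_gt0.
  by rewrite order_dvdn expQ ?mem_quotient.
rewrite -card_quotient // defQ (@leq_trans (#|X| * #|Y|)%N) //; last first.
  by rewrite -mulnn leq_mul // le_p.
by rewrite mul_cardG leq_pmulr // cardG_gt0.
Qed.

Lemma maximal_sub M : maximal M G -> M \subset G.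
Proof. by move/maxgroupp/proper_sub. Qed.

Lemma max_index_sub_eq p M N :
  M \in max_index p -> maximal N G -> M \subset N -> M = N.
Proof.
move=> /max_indexP[/maxgroupP[_ maxM] _] /maxgroupp ltNG sMN.
by apply: val_inj => /=; rewrite (maxM N).
Qed.

(** The intersection of two members of [max_index p] already has index [p ^ 2], the
    largest possible index of [frat_at p]. *)
Lemma max_index_inter p M N :
    M \in max_index p -> N \in max_index p -> M != N ->
  M :&: N = frat_at p /\ #|G : frat_at p| = (p ^ 2)%N.
Proof.
move=> maxM maxN neqMN; have p_pr := max_index_prime maxM.
have [mM iM] := max_indexP _ _ maxM; have [mN iN] := max_indexP _ _ maxN.
have [sMG sNG] := (maximal_sub mM, maximal_sub mN).
have defG : M * N = G.
  apply: mulg_normal_maximal => //; first exact: maximal_nil_normal.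
  by apply: contra neqMN => /(max_index_sub_eq maxN mM) ->.
have iMN : #|G : M :&: N| = (p ^ 2)%N.
  rewrite -(Lagrange_index sMG (subsetIl M N)) iM indexgI -mulnn; congr (_ * _)%N.
  apply/eqP; rewrite -(eqn_pmul2r (cardG_gt0 N)) LagrangeMr defG.
  by rewrite -(Lagrange sNG) iN mulnC.
have sD : frat_at p \subset M :&: N by rewrite subsetI !frat_at_sub.
have := index_frat_at_le p_pr.
rewrite -(Lagrange_index (subset_trans (subsetIl M N) sMG) sD) iMN.
rewrite -[X in _ <= X]muln1 leq_pmul2l ?expn_gt0 ?prime_gt0 // => le1.
have /eqP i1 : #|M :&: N : frat_at p| == 1%N by rewrite eqn_leq le1 indexg_gt0.
split; last by rewrite i1 muln1.
by apply/eqP; rewrite eqEsubset sD andbT -indexg_eq1 i1.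
Qed.

Lemma index_frat_at p : 1 < #|max_index p| -> #|G : frat_at p| = (p ^ 2)%N.
Proof. by case/card_gt1P=> M [N [maxM maxN /(max_index_inter maxM maxN)[]]]. Qed.

Lemma max_index_gt1_prime p : 1 < #|max_index p| -> prime p.
Proof. by case/card_gt1P=> M [N [/max_index_prime]]. Qed.

Definition frat_join p x := (<[x]> <*> frat_at p)%G.

Lemma mem_frat_join p x : x \in frat_join p x.
Proof. by rewrite mem_gen // inE cycle_id. Qed.

Lemma frat_join_max p x :
    1 < #|max_index p| -> x \in G -> x \notin frat_at p ->
  frat_join p x \in max_index p.
Proof.
move=> gt1 Gx notDx; have p_pr := max_index_gt1_prime gt1.
have /andP[sDG nDG] := frat_at_normal p; have Nx := subsetP nDG x Gx.
have sHG : frat_join p x \subset G by rewrite join_subG cycle_subG Gx.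
have sDH : frat_at p \subset frat_join p x by rewrite joing_subr.
have iH : #|frat_join p x : frat_at p| = p.
  rewrite -card_quotient ?(subset_trans sHG) // quotientYidr ?cycle_subG //.
  rewrite quotient_cycle //; apply: (abelem_order_p (frat_at_abelem p_pr)).
    by rewrite mem_quotient.
  by apply: contra notDx => /eqP; apply: coset_idr.
have iG : #|G : frat_join p x| = p.
  apply/eqP; rewrite -(eqn_pmul2r (prime_gt0 p_pr)) -[X in (_ * X)%N == _]iH.
  by rewrite Lagrange_index // index_frat_at.
by apply/max_indexP; split=> //; apply: p_index_maximal; rewrite ?iG.
Qed.

Lemma frat_join_unique p x M :
    1 < #|max_index p| -> M \in max_index p -> x \in M -> x \notin frat_at p ->
  frat_join p x = M.
Proof.
move=> gt1 maxM Mx notDx; have [mM _] := max_indexP _ _ maxM.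
have Gx := subsetP (maximal_sub mM) x Mx.
apply: (max_index_sub_eq (frat_join_max gt1 Gx notDx) mM).
by rewrite join_subG cycle_subG Mx frat_at_sub.
Qed.

Lemma max_index_cover p x :
  1 < #|max_index p| -> x \in G -> exists2 M, M \in max_index p & x \in M.
Proof.
move=> gt1 Gx; have [Dx|notDx] := boolP (x \in frat_at p).
  have /card_gt1P[M [_ [maxM _ _]]] := gt1.
  by exists M => //; rewrite (subsetP (frat_at_sub maxM)).
by exists (frat_join p x); [exact: frat_join_max | exact: mem_frat_join].
Qed.

(** If [x] and [y] each lie in only one of two maximal subgroups of index [p],
    then [x * y] lies in neither, hence in a third one. *)
Lemma max_index_gt2 p : 1 < #|max_index p| -> 2 < #|max_index p|.
Proof.
move=> gt1; have /card_gt1P[M [N [maxM maxN neqMN]]] := gt1.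
have [[mM _] [mN _]] := (max_indexP _ _ maxM, max_indexP _ _ maxN).
have /subsetPn[x Mx notNx] : ~~ (M \subset N).
  by apply: contra neqMN => /(max_index_sub_eq maxM mN) ->.
have /subsetPn[y Ny notMy] : ~~ (N \subset M).
  by apply: contra neqMN => /(max_index_sub_eq maxN mM) ->.
have Gxy : x * y \in G.
  by rewrite groupM ?(subsetP (maximal_sub mM) x) ?(subsetP (maximal_sub mN) y).
have [K maxK Kxy] := max_index_cover gt1 Gxy.
apply/card_gt2P; exists M, N, K; split=> //.
split=> //; first by apply: contraTneq Kxy => <-; rewrite groupMr.
by apply: contraTneq Kxy => ->; rewrite groupMl.
Qed.

(** * Coordinates of the generating graph *)

(** A union of cosets of [K] and a supplement [H] of [K] are independent events in
    [G].  Count the pairs of [x \in U] and [u \in K] with [x * u \in H]: each [x]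
    occurs with [#|K :&: H|] elements [u], and each [u] with [#|U :&: H|] elements
    [x]. *)
Lemma card_setI_supplement (U : {set gT}) (H K : {group gT}) :
    U \subset G -> H * K = G -> {in U & K, forall x u, x * u \in U} ->
  (#|U :&: H| * #|G| = #|U| * #|H|)%N.
Proof.
move=> sUG defG UK.
have pairs : (#|U :&: H| * #|K| = #|U| * #|K :&: H|)%N.
  transitivity (\sum_(x in U) \sum_(u in K | (x * u)%g \in H) 1)%N; last first.
    rewrite -sum_nat_const; apply: eq_bigr => x Ux.
    have /mulsgP[h k Hh Kk ->] : x \in H * K by rewrite defG (subsetP sUG).
    rewrite sum1dep_card -(card_lcoset (K :&: H) k^-1); apply: eq_card => u.
    by rewrite mem_lcoset invgK !inE -mulgA (groupMl _ Hh) (groupMl _ Kk).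
  rewrite (exchange_big_dep (mem K)) => [|x u _ /andP[]//].
  rewrite mulnC -sum_nat_const; apply: eq_bigr => u Ku.
  rewrite sum1dep_card -(card_rcoset (U :&: H) u^-1); apply: eq_card => x.
  rewrite mem_rcoset invgK !inE Ku /=; congr (_ && _).
  apply/idP/idP=> [Uxu|Ux]; last exact: UK.
  by rewrite -(mulgK u x) UK ?groupV.
apply/eqP; rewrite -(eqn_pmul2r (cardG_gt0 (H :&: K))) -mulnA -[in X in X == _]defG.
by rewrite -mul_cardG mulnCA pairs setIC mulnA [(#|H| * _)%N]mulnC.
Qed.

(** A single maximal subgroup of index [p] gives no coordinate: an element outside
    [frat_at p] then avoids it, whatever the other generator is. *)
Definition free_index := {i : 'I_#|G|.+1 | 1 < #|max_index i|}.

Definition prime_of (i : free_index) : nat := val (val i).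

Definition coords x : {ffun free_index -> {group gT}} :=
  [ffun i => frat_join (prime_of i) x].

Definition max_box := box (fun i => max_index (prime_of i)).

(** The condition concerns only those [p] that are the index of some maximal
    subgroup; for the others [frat_at p] is [G]. *)
Definition frat_free : {set gT} :=
  [set x in G | [forall (M : {group gT} | maximal M G), x \notin frat_at #|G : M|]].

Lemma frat_freeP x :
  reflect (x \in G /\ forall p M, M \in max_index p -> x \notin frat_at p)
          (x \in frat_free).
Proof.
rewrite inE; apply: (iffP andP) => -[Gx Fx]; split=> //.
  by move=> p M /max_indexP[maxM <-]; apply: (forall_inP Fx).
by apply/forall_inP=> M maxM; apply: (Fx _ M); apply/max_indexP.
Qed.

Lemma prime_of_gt1 i : 1 < #|max_index (prime_of i)|.
Proof. exact: valP i. Qed.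

Lemma free_indexP p : 1 < #|max_index p| -> exists i, prime_of i = p.
Proof.
move=> gt1; have /card_gt1P[M [_ [/max_indexP[maxM iM] _ _]]] := gt1.
have lt_p : p < #|G|.+1.
  by rewrite ltnS -iM -(Lagrange (maximal_sub maxM)) leq_pmull.
by exists (exist _ (Ordinal lt_p) gt1).
Qed.

Lemma max_box_gt2 (i : free_index) : 2 < #|max_index (prime_of i)|.
Proof. exact/max_index_gt2/prime_of_gt1. Qed.

Lemma frat_free_notin x i : x \in frat_free -> x \notin frat_at (prime_of i).
Proof.
move=> /frat_freeP[_ Fx]; have /card_gt1P[M [_ [maxM _ _]]] := prime_of_gt1 i.
exact: Fx maxM.
Qed.

Lemma coords_box x :
  x \in G -> (forall i, x \notin frat_at (prime_of i)) -> coords x \in max_box.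
Proof.
move=> Gx notDx; apply/boxP=> i; rewrite ffunE.
by apply: frat_join_max => //; apply: prime_of_gt1.
Qed.

Lemma coords_frat_free x : x \in frat_free -> coords x \in max_box.
Proof.
move=> Fx; apply: coords_box => [|i]; last exact: frat_free_notin.
by case/frat_freeP: Fx.
Qed.

Lemma frat_at_pcore p : prime p -> frat_at p * 'O_p(G) = G.
Proof.
move=> p_pr; have /dprodW defG := nilpotent_pcoreC p G_nil.
apply/eqP; rewrite eqEsubset mul_subG ?pcore_sub ?subsetIl //=.
have nDP : 'O_p(G) \subset 'N(frat_at p).
  by rewrite (subset_trans (pcore_sub _ _)) ?(normal_norm (frat_at_normal p)).
rewrite -(normC nDP) -{1}defG mulgS //; apply/subsetP=> x p'x.
apply: p'elt_frat_at; first by rewrite (subsetP (pcore_sub _ _) x p'x).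
exact: mem_p_elt (pcore_pgroup _ _) p'x.
Qed.

Lemma pcore_max_index p q M x :
  M \in max_index q -> p != q -> x \in 'O_p(G) -> x \in M.
Proof.
move=> maxM neq_pq Px; apply: (p'elt_max_index maxM).
  by rewrite (subsetP (pcore_sub _ _) x Px).
apply: sub_p_elt (mem_p_elt (pcore_pgroup _ _) Px) => r.
by rewrite !inE => /eqP->.
Qed.

(** The points of the fibre of [w], with the condition at the coordinate [i]
    left out. *)
Definition cofiber i (w : {ffun free_index -> {group gT}}) : {set gT} :=
  [set x in G | [forall (M : {group gT} | maximal M G),
                   (#|G : M| != prime_of i) ==> (x \notin frat_at #|G : M|)]
              & [forall (j | j != i), x \in w j]].

Definition fiber w : {set gT} := [set x in frat_free | coords x == w].

Lemma fiberE i w :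
  w \in max_box -> fiber w = (cofiber i w :&: w i) :\: frat_at (prime_of i).
Proof.
move=> /boxP Bw; apply/setP=> x; rewrite inE; apply/andP/idP.
  case=> Fx /eqP <-; rewrite in_setD frat_free_notin //= in_setI ffunE.
  rewrite mem_frat_join andbT.
  have [Gx notDx] := frat_freeP _ Fx; rewrite inE Gx /=; apply/andP; split.
    apply/forall_inP=> M maxM; apply/implyP=> _; apply: (notDx _ M).
    exact/max_indexP.
  by apply/forall_inP=> j _; rewrite ffunE mem_frat_join.
case/setDP=> /setIP[]; rewrite inE => /and3P[Gx /forall_inP nD /forall_inP cw] wx nDx.
have Fx : x \in frat_free.
  apply/frat_freeP; split=> // p M maxM; have [mM iM] := max_indexP _ _ maxM.
  have [->//|neq_p] := eqVneq p (prime_of i).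
  by have /implyP := nD M mM; rewrite iM => /(_ neq_p).
split=> //; apply/eqP/ffunP=> j; rewrite ffunE.
apply: frat_join_unique (prime_of_gt1 j) (Bw j) _ (frat_free_notin j Fx).
by have [->//|/cw] := eqVneq j i.
Qed.

Lemma prime_of_inj : injective prime_of.
Proof. by move=> i j /val_inj/val_inj. Qed.

(** Elements of ['O_p(G)] belong to all maximal subgroups of an index other than
    [p], so multiplying by them affects only the condition at [p]. *)
Lemma cofiber_pcore i w :
    w \in max_box ->
  {in cofiber i w & 'O_(prime_of i)(G), forall x u, x * u \in cofiber i w}.
Proof.
move=> /boxP Bw x u; rewrite !inE => /and3P[Gx /forall_inP nD /forall_inP cw] Pu.
have Gu := subsetP (pcore_sub _ _) u Pu.
rewrite groupM //=; apply/andP; split; last first.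
  apply/forall_inP=> j neq_ji; rewrite groupMr ?cw //.
  by apply: pcore_max_index (Bw j) _ Pu; rewrite eq_sym (inj_eq prime_of_inj).
apply/forall_inP=> M maxM; apply/implyP=> neq_p.
rewrite groupMr ?(implyP (nD M maxM)) //.
apply/frat_atP; split=> // N maxN; apply: pcore_max_index maxN _ Pu.
by rewrite eq_sym.
Qed.

(** The cofibre at [i] is the same for [w] and for its update, and it meets all
    maximal subgroups of index [prime_of i] in the same number of elements. *)
Lemma card_fiber_update w i b :
    w \in max_box -> b \in max_index (prime_of i) ->
  #|fiber (update w i b)| = #|fiber w|.
Proof.
move=> Bw maxb; set w' := update w i b.
have Bw' : w' \in max_box by apply: update_box.
have eqU : cofiber i w' = cofiber i w.
  apply/setP=> x; rewrite !inE; congr [&& _, _ & _]; apply: eq_forallb => j.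
  by rewrite updateE; case: eqVneq.
have maxw : w i \in max_index (prime_of i) by move/boxP: Bw.
have p_pr := max_index_prime maxb.
have cardI (M : {group gT}) : M \in max_index (prime_of i) ->
    (#|cofiber i w :&: M| * #|G| = #|cofiber i w| * #|M|)%N.
  move=> maxM; apply: (@card_setI_supplement _ _ 'O_(prime_of i)(G)).
  - by apply/subsetP=> x; rewrite inE => /andP[].
  - apply/eqP; rewrite eqEsubset mul_subG ?pcore_sub ?(normal_sub (max_index_normal maxM)) //=.
    by rewrite -{1}(frat_at_pcore p_pr) mulSg ?frat_at_sub.
  exact: cofiber_pcore.
have cardM : #|w i| = #|b|.
  have [_ iw] := max_indexP _ _ maxw; have [_ ib] := max_indexP _ _ maxb.
  apply/eqP; rewrite -(eqn_pmul2r (prime_gt0 p_pr)) -[X in (_ * X)%N == _]iw -ib.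
  by rewrite !Lagrange // normal_sub ?(max_index_normal maxw) ?(max_index_normal maxb).
have D_I (M : {group gT}) : M \in max_index (prime_of i) ->
    cofiber i w :&: M :&: frat_at (prime_of i) = cofiber i w :&: frat_at (prime_of i).
  by move=> maxM; rewrite -setIA (setIidPr (frat_at_sub maxM)).
rewrite !(@fiberE i) // eqU updateE eqxx !cardsD !D_I //; congr (_ - _)%N.
by apply/eqP; rewrite -(eqn_pmul2r (cardG_gt0 G)) !cardI // cardM.
Qed.

Lemma card_fiber_const w0 :
  w0 \in max_box -> {in max_box, forall w, #|fiber w| = #|fiber w0|}.
Proof.
move=> Bw0; apply: (box_ind Bw0) => // w i b Bw maxb <-; exact: card_fiber_update.
Qed.

Lemma box_adj_gen u v :
    u \in G -> (forall i, u \notin frat_at (prime_of i)) -> v \in frat_free ->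
  box_adj (coords u) (coords v) -> <<[set u; v]>> == G.
Proof.
move=> Gu nDu Fv /forallP adj_uv; have [Gv nDv] := frat_freeP _ Fv.
apply/gen2P=> // M maxM Mu; apply/negP=> Mv.
have maxM' : M \in max_index #|G : M| by apply/max_indexP.
have [/free_indexP[i def_i]|le1] := ltnP 1 #|max_index #|G : M| |.
  have := adj_uv i; rewrite !ffunE; rewrite -def_i in maxM'.
  rewrite (frat_join_unique (prime_of_gt1 i) maxM' Mu (nDu i)).
  by rewrite (frat_join_unique (prime_of_gt1 i) maxM' Mv (frat_free_notin i Fv)) eqxx.
case/negP: (nDv _ M maxM'); apply/frat_atP; split=> // N maxN.
by have /card_le1_eqP/(_ N M maxN maxM') <- := le1.
Qed.

Lemma gen_notin u v i :
  u \in G -> v \in G -> <<[set u; v]>> == G -> u \notin frat_at (prime_of i).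
Proof.
move=> Gu Gv /gen2P-/(_ Gu Gv) noM.
have [M maxM Mv] := max_index_cover (prime_of_gt1 i) Gv.
apply: contraL Mv => Du; have [mM _] := max_indexP _ _ maxM.
by apply: noM => //; apply: (subsetP (frat_at_sub maxM)).
Qed.

Lemma gen_box_adj u v :
  u \in G -> v \in G -> <<[set u; v]>> == G -> box_adj (coords u) (coords v).
Proof.
move=> Gu Gv guv; apply/forallP=> i; rewrite !ffunE; apply/eqP=> eq_uv.
have := frat_join_max (prime_of_gt1 i) Gu (gen_notin i Gu Gv guv).
case/max_indexP=> mM _.
have := gen2P Gu Gv guv _ mM (mem_frat_join _ u).
by rewrite eq_uv mem_frat_join.
Qed.

Lemma frat_at_constt p (pi : nat_pred) x :
  x \in G -> p \notin pi -> x.`_pi \in frat_at p.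
Proof.
move=> Gx pi'p; apply: p'elt_frat_at; first exact: groupX.
by apply: pi_p'nat (p_elt_constt pi x) _.
Qed.

Lemma constt_notin_frat_at p (pi : nat_pred) x :
  x \in G -> x \notin frat_at p -> p \in pi -> x.`_pi \notin frat_at p.
Proof.
move=> Gx notDx pi_p; apply: contra notDx => Dx; rewrite -(consttC pi x).
by rewrite groupM // frat_at_constt // inE /= negbK.
Qed.

(** For each prime [p], at least one of the two generators lies outside the
    intersection of the maximal subgroups of index [p]; keep the [p]-part of that
    one. *)
Lemma frat_free_exists : exists x, x \in frat_free.
Proof.
have [x [y defG]] := G_2gen.
have [Gx Gy] : x \in G /\ y \in G by rewrite defG !mem_gen ?set21 ?set22.
pose pi : nat_pred := [pred p | x \notin frat_at p].
exists (x.`_pi * y.`_pi^'); apply/frat_freeP; split=> [|p M maxM].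
  by rewrite groupM ?groupX.
have [Dx|notDx] := boolP (x \in frat_at p); last first.
  have Dy : y.`_pi^' \in frat_at p by rewrite frat_at_constt // inE /= !negbK.
  by rewrite groupMr // constt_notin_frat_at.
have Dx' : x.`_pi \in frat_at p by rewrite frat_at_constt // inE /= negbK.
rewrite groupMl // constt_notin_frat_at //; last by rewrite inE /= inE /= negbK.
apply/negP=> Dy.
have [mM _] := max_indexP _ _ maxM; have sDM := subsetP (frat_at_sub maxM).
have /gen2P-/(_ Gx Gy M mM (sDM x Dx)) : <<[set x; y]>> == G by rewrite -defG.
by rewrite sDM.
Qed.

(** At a prime with a single maximal subgroup, [w] contributes nothing to the
    generation, so [v] must. *)
Lemma gen_frat_free w v :
    w \in G -> v \in G ->
    (forall p M, M \in max_index p -> #|max_index p| <= 1 -> w \in frat_at p) ->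
  <<[set w; v]>> == G -> v \in frat_free.
Proof.
move=> Gw Gv Dw gwv; apply/frat_freeP; split=> // p M maxM.
have [/free_indexP[i <-]|le1] := ltnP 1 #|max_index p|.
  by apply: (@gen_notin v w) => //; rewrite setUC.
have [mM _] := max_indexP _ _ maxM; have sDM := subsetP (frat_at_sub maxM).
have := gen2P Gw Gv gwv M mM (sDM w (Dw p M maxM le1)).
by apply: contra; apply: sDM.
Qed.

(** Take the part of a generator at the primes with several maximal subgroups. *)
Lemma sparse_vertex_exists : exists w,
  [/\ w \in G, forall i, w \notin frat_at (prime_of i)
    & forall p M, M \in max_index p -> #|max_index p| <= 1 -> w \in frat_at p].
Proof.
have [x [y defG]] := G_2gen.
have [Gx Gy] : x \in G /\ y \in G by rewrite defG !mem_gen ?set21 ?set22.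
exists x.`_[pred p | 1 < #|max_index p|]; split=> [|i|p M _ le1].
- exact: groupX.
- apply: constt_notin_frat_at => //; last exact: prime_of_gt1.
  by apply: (@gen_notin x y) => //; rewrite -defG.
by rewrite frat_at_constt // inE /= -leqNgt.
Qed.

Lemma Delta_vertsP u :
  reflect (u \in G /\ exists2 v, v \in G & gen_adj G u v) (u \in verts (Delta G)).
Proof.
rewrite /= !inE andbA andbb -lt0n; apply: (iffP andP) => -[Gu].
  by case/card_gt0P=> v; rewrite inE => /andP[Gv adj_uv]; split=> //; exists v.
by case=> v Gv adj_uv; split=> //; apply/card_gt0P; exists v; rewrite inE Gv.
Qed.

Lemma Delta_verts_notin u i : u \in verts (Delta G) -> u \notin frat_at (prime_of i).
Proof. by case/Delta_vertsP=> Gu [v Gv /andP[_ guv]]; apply: gen_notin guv. Qed.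

Definition free_degree : nat :=
  (#|fiber (coords (xchoose frat_free_exists))|
   * box_degree (fun i => max_index (prime_of i)))%N.

Lemma card_fiber w :
  w \in max_box -> #|fiber w| = #|fiber (coords (xchoose frat_free_exists))|.
Proof.
by apply: card_fiber_const; rewrite coords_frat_free // (xchooseP frat_free_exists).
Qed.

Lemma free_degree_gt0 : 0 < free_degree.
Proof.
rewrite muln_gt0; apply/andP; split.
  apply/card_gt0P; exists (xchoose frat_free_exists).
  by rewrite inE (xchooseP frat_free_exists) eqxx.
by apply: prodn_gt0 => i; rewrite -subn1 subn_gt0 ltnW ?max_box_gt2.
Qed.

Definition free_nbrs u : {set gT} :=
  [set v in frat_free | box_adj (coords u) (coords v)].

Lemma card_free_nbrs u :
  u \in G -> (forall i, u \notin frat_at (prime_of i)) -> #|free_nbrs u| = free_degree.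
Proof.
move=> Gu nDu; apply: (card_blowup_adj coords_frat_free card_fiber).
exact: coords_box.
Qed.

Lemma free_nbrs_gen u v :
    u \in G -> (forall i, u \notin frat_at (prime_of i)) -> v \in free_nbrs u ->
  <<[set u; v]>> == G.
Proof. by move=> Gu nDu; rewrite inE => /andP[]; apply: box_adj_gen. Qed.

Lemma Delta_vertsE u :
    1 < #|G| -> u \in G -> (forall i, u \notin frat_at (prime_of i)) ->
  u \in verts (Delta G).
Proof.
move=> G_gt1 Gu nDu.
have /card_gt0P[v Nv] : 0 < #|free_nbrs u| by rewrite card_free_nbrs ?free_degree_gt0.
have guv := free_nbrs_gen Gu nDu Nv.
have Gv : v \in G by move: Nv; rewrite inE => /andP[/frat_freeP[]].
apply/Delta_vertsP; split=> //.
(* If [G] is cyclic, the neighbour found may be [u] itself; then [u] generates [G]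
   and every other element is adjacent to it. *)
have [eq_uv|neq_uv] := eqVneq u v; last by exists v; rewrite // /gen_adj neq_uv.
have [t Gt neq_ut] : exists2 t, t \in G & u != t.
  have [a [b [Ga Gb neq_ab]]] := card_gt1P G_gt1.
  by have [eq_ua|] := eqVneq u a; [exists b; rewrite // eq_ua | exists a].
exists t => //; rewrite /gen_adj neq_ut eqEsubset gen_subG subUset !sub1set Gu Gt /=.
by rewrite -(eqP guv) -eq_uv setUid genS // subsetUl.
Qed.

(** The bound is the degree of the vertex of [sparse_vertex_exists], all of whose
    neighbours are in [frat_free] by [gen_frat_free]. *)
Lemma min_degree_Delta_le : 1 < #|G| -> min_degree (Delta G) <= free_degree.
Proof.
move=> G_gt1; have [w [Gw nDw Dw]] := sparse_vertex_exists.
apply: leq_trans (min_degree_le (Delta_vertsE G_gt1 Gw nDw)) _.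
rewrite -(card_free_nbrs Gw nDw); apply/subset_leq_card/subsetP=> v.
rewrite inE => /andP[/Delta_vertsP[Gv _] /andP[_ gwv]].
by rewrite inE (gen_frat_free Gw Gv Dw gwv) gen_box_adj.
Qed.

(** If [S] is smaller, every vertex left is joined to [frat_free :\: S], and
    [blowup_cut] shows that [frat_free :\: S] is connected. *)
Lemma Delta_cut_ge (S : {set gT}) :
    1 < #|G| -> disconnected (induced (Delta G) (~: S)) -> free_degree <= #|S|.
Proof.
move=> G_gt1; rewrite leqNgt; apply: contraTN => ltSd.
set Γ := induced _ _.
set e := [rel u v | [&& u \in verts Γ, v \in verts Γ & adj Γ u v]].
have e_sym : connect_sym e.
  by apply: sym_connect_sym => u v; rewrite /= gen_adj_sym andbCA.
have nDv u : u \in verts Γ -> u \in G /\ forall i, u \notin frat_at (prime_of i).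
  by case/setIP=> Vu _; split=> [|i]; [case/Delta_vertsP: Vu | apply: Delta_verts_notin].
have free_verts u : u \in frat_free :\: S -> u \in verts Γ.
  case/setDP=> Fu nSu; rewrite inE [_ \in ~: S]inE nSu andbT Delta_vertsE //.
    by case/frat_freeP: Fu.
  by move=> i; apply: frat_free_notin.
have gen_connect u v :
    u \in verts Γ -> v \in verts Γ -> <<[set u; v]>> == G -> connect e u v.
  move=> Vu Vv guv; have [->|neq_uv] := eqVneq u v; first exact: connect0.
  by apply: connect1; rewrite /= Vu Vv /gen_adj neq_uv.
have to_free u : u \in verts Γ -> exists2 v, v \in frat_free :\: S & connect e u v.
  move=> Vu; have [Gu nDu] := nDv u Vu.
  have /subsetPn[v Nv nSv] : ~~ (free_nbrs u \subset S).
    by apply: contraL ltSd => /subset_leq_card; rewrite card_free_nbrs // leqNgt.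
  have Rv : v \in frat_free :\: S by move: Nv; rewrite !inE nSv => /andP[].
  by exists v => //; apply: gen_connect => //; [exact: free_verts | exact: free_nbrs_gen].
have free_connect r v :
    r \in frat_free :\: S -> v \in frat_free :\: S -> connect e r v.
  move=> Rr Rv; apply: contraLR ltSd => nrv; rewrite -leqNgt.
  pose X := [set x in frat_free :\: S | connect e r x].
  have XP x : (x \in X) = (x \in frat_free :\: S) && connect e r x by rewrite inE.
  apply: (blowup_cut max_box_gt2 coords_frat_free card_fiber
            (X := X) (Y := (frat_free :\: S) :\: X)).
  - by apply/set0Pn; exists r; rewrite XP Rr connect0.
  - by apply/set0Pn; exists v; rewrite in_setD Rv XP Rv nrv.
  - rewrite setDE setUIr setUCr setIT.
    by apply/setUidPr/subsetP=> x; rewrite XP => /andP[].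
  move=> x y Xx; rewrite in_setD => /andP[nXy Ry]; rewrite -negb_or.
  move: Xx; rewrite XP => /andP[Rx rx]; apply: contra nXy; rewrite XP Ry /=.
  case/orP=> [/eqP<-//|adj_xy]; apply: connect_trans rx _.
  have [Gx nDx] := nDv x (free_verts x Rx).
  apply: gen_connect (free_verts x Rx) (free_verts y Ry) _; apply: box_adj_gen => //.
  by case/setDP: Ry.
apply/exists_inPn=> u Vu; apply/exists_inPn=> v Vv; rewrite negbK.
have [r Rr ur] := to_free u Vu; have [s Rs vs] := to_free v Vv.
apply: connect_trans ur (connect_trans (free_connect r s Rr Rs) _).
by rewrite e_sym.
Qed.

End MaximalSubgroups.

Theorem theorem1 (gT : finGroupType) (G : {group gT})
    (G_nil : nilpotent G) (G_2gen : two_generated G) :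
  maximally_connected (Delta G).
Proof.
apply: maximally_connectedP => S /forall_inPn[u Vu _] _ cutS.
have /Delta_vertsP[Gu [v Gv /andP[neq_uv _]]] := Vu.
have G_gt1 : 1 < #|G| by apply/card_gt1P; exists u, v.
apply: leq_trans (min_degree_Delta_le G_nil G_2gen G_gt1) _.
exact: Delta_cut_ge.
Qed.
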